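(* Let $\mathcal{A}$ be an abelian category with enough projectives (for example, the category of left modules over a ring) and let $F:\mathcal{A}\to\mathbf{Ab}$ be an additive covariant functor. Consider the left fundamental sequence of $F$, i.e. the sequence of functors and natural transformations $$\cdots\to S_3F\to\underline{F}\circ\Omega^3\to L_2F\to S_2F\to\underline{F}\circ\Omega^2\to L_1F\to S_1F\to\underline{F}\circ\Omega\xrightarrow{\alpha_F}L_0F\xrightarrow{\lambda_F}F\to\underline{F}\to0 .$$ Then: (1) The left fundamental sequence is a complex whose homology is zero except, possibly, at the terms $L_iF$. (2) If $F$ is half-exact, then the sequence is exact. (3) If $F$ is mono-preserving, then $\alpha_F$ is monic. (4) If $F$ is epi-preserving, then $\underline{F}=0$ and $\lambda_F$ is epic. (5) $\lambda_F$ is an isomorphism if and only if $F$ is right-exact.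
   Context: $\mathbf{Ab}$ is the category of abelian groups. A covariant additive functor $F$ is half-exact if for each short exact sequence $0\to A\to B\to C\to0$ the sequence $F(A)\to F(B)\to F(C)$ is exact at $F(B)$. Construction of the left fundamental sequence. For an object $B$ choose a projective resolution $\cdots\to P_1\xrightarrow{d_1}P_0\to B\to0$. Put $\Omega^0B=B$, let $e_0:P_0\to B$ be the given epimorphism, and for $i\ge0$ let $m_i:\Omega^{i+1}B\to P_i$ be the kernel of $e_i:P_i\to\Omega^iB$ and $e_{i+1}:P_{i+1}\to\Omega^{i+1}B$ the epimorphism with $d_{i+1}=m_ie_{i+1}$. Define: - $L_iF(B)=\mathrm{Ker}\,F(d_i)/\mathrm{Im}\,F(d_{i+1})$ (with $\mathrm{Ker}\,F(d_0):=F(P_0)$), the left-derived functors ($L_0F$ need not equal $F$); - the quot-stabilization $\underline{F}(B)=\mathrm{Coker}(F(e_0):F(P_0)\to F(B))$, which equals the cokernel of the canonical map $\lambda_F:L_0F\to F$ induced by $F(e_0)$; since $\underline{F}$ vanishes on projectives, $\underline{F}\circ\Omega^i$ is a well-defined functor, with $(\underline{F}\circ\Omega^i)(B)=\underline{F}(\Omega^iB)=\mathrm{Coker}\,F(e_i)$; - the left satellites $S_0F=F$ and, for $i\ge1$, $S_iF(B)=\mathrm{Ker}(F(m_{i-1}):F(\Omega^iB)\to F(P_{i-1}))$. These are independent of the choice of resolution and functorial in $B$. The maps of the sequence, for $i\ge0$, are: $L_iF(B)\to S_iF(B)$ is induced by $F(e_i):F(P_i)\to F(\Omega^iB)$ (for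 $i=0$ this is $\lambda_F$); $S_iF(B)\to\underline{F}(\Omega^iB)$ is the inclusion into $F(\Omega^iB)$ followed by the projection onto $\mathrm{Coker}\,F(e_i)$; $\underline{F}(\Omega^{i+1}B)\to L_iF(B)$ is induced by $F(m_i):F(\Omega^{i+1}B)\to\mathrm{Ker}\,F(d_i)$ (for $i=0$ this is $\alpha_F$). *)

(* Defs.v *)
From HB Require Import structures.
From mathcomp Require Import all_boot all_algebra.
From mathcomp Require Import boolp.

Set Implicit Arguments.
Unset Strict Implicit.
Unset Printing Implicit Defensive.

Import GRing.Theory.
Local Open Scope ring_scope.
Local Open Scope quotient_scope.

(** The category Ab is rendered by [zmodType] and additive maps; the choice
    structure carried by a [zmodType] is classically always available. *)

Section AbKernel.
Variables (A B : zmodType) (f : {additive A -> B}).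

Definition ab_ker_pred : A -> bool := fun x => f x == 0.

Lemma ab_ker_closed : zmod_closed ab_ker_pred.
Proof.
split=> [|x y]; rewrite !unfold_in /ab_ker_pred ?raddf0 //.
by move=> /eqP fx /eqP fy; rewrite raddfB fx fy subrr.
Qed.

HB.instance Definition _ := GRing.isZmodClosed.Build A ab_ker_pred ab_ker_closed.

Record ab_ker := AbKer { ab_ker_val :> A; _ : ab_ker_val \in ab_ker_pred }.

HB.instance Definition _ := [isSub for ab_ker_val].
HB.instance Definition _ := [Choice of ab_ker by <:].
HB.instance Definition _ := [SubChoice_isSubZmodule of ab_ker by <:].

Definition ab_ker_incl : {additive ab_ker -> A} := val.

Lemma ab_ker_inclP (x : ab_ker) : f (ab_ker_incl x) = 0.
Proof. by apply/eqP; exact: (valP x). Qed.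

Lemma ab_ker_incl_inj : injective ab_ker_incl.
Proof. exact: val_inj. Qed.

Section Lift.
Variables (X : zmodType) (h : {additive X -> A}).
Hypothesis h0 : forall x, f (h x) = 0.

Lemma ab_ker_lift_subproof x : h x \in ab_ker_pred.
Proof. exact/eqP/h0. Qed.

Definition ab_ker_lift_fun (x : X) : ab_ker := AbKer (ab_ker_lift_subproof x).

Lemma ab_ker_lift_is_additive : zmod_morphism ab_ker_lift_fun.
Proof. by move=> x y; apply: val_inj; rewrite /= raddfB. Qed.

HB.instance Definition _ :=
  GRing.isZmodMorphism.Build X ab_ker ab_ker_lift_fun ab_ker_lift_is_additive.

Definition ab_ker_lift : {additive X -> ab_ker} := ab_ker_lift_fun.

Lemma ab_ker_liftE x : ab_ker_incl (ab_ker_lift x) = h x.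
Proof. by []. Qed.
End Lift.
End AbKernel.

Section AbCokernel.
Variables (A B : zmodType) (f : {additive A -> B}).

Definition ab_im_pred : B -> bool := fun y => `[< exists x, f x = y >].

Lemma ab_im_closed : zmod_closed ab_im_pred.
Proof.
split=> [|x y]; rewrite !unfold_in /ab_im_pred.
  by apply/asboolP; exists 0; rewrite raddf0.
move=> /asboolP[a <-] /asboolP[b <-].
by apply/asboolP; exists (a - b); rewrite raddfB.
Qed.

HB.instance Definition _ := GRing.isZmodClosed.Build B ab_im_pred ab_im_closed.

Definition ab_im : zmodClosed B := GRing.ZmodClosed.clone B ab_im_pred _.

Definition ab_coker : zmodType := Quotient.quot ab_im.

Definition ab_coker_proj : {additive B -> ab_coker} :=
  \pi_(Quotient.quot ab_im).

Lemma ab_coker_proj_surj (z : ab_coker) : exists y, ab_coker_proj y = z.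
Proof. by exists (repr (z : Quotient.quot ab_im)); exact: reprK. Qed.

Lemma ab_coker_proj_eq0 y : ab_coker_proj y = 0 <-> exists x, f x = y.
Proof.
have -> : (ab_coker_proj y = 0) = (y == 0 %[mod Quotient.quot ab_im]).
  rewrite propeqE; split=> [/= yE|/eqP /= ->]; last exact: raddf0 ab_coker_proj.
  by apply/eqP; rewrite [LHS]yE; exact: esym (raddf0 ab_coker_proj).
by rewrite -Quotient.idealrBE subr0; split=> [/asboolP//|?]; exact/asboolP.
Qed.

Section Desc.
Variables (X : zmodType) (h : {additive B -> X}).
Hypothesis h0 : forall x, h (f x) = 0.

Definition ab_coker_desc_fun (z : ab_coker) : X :=
  h (repr (z : Quotient.quot ab_im)).

Lemma ab_coker_desc_funE y : ab_coker_desc_fun (ab_coker_proj y) = h y.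
Proof.
apply/eqP; rewrite -subr_eq0 -raddfB; apply/eqP.
set y' := repr _; have /ab_coker_proj_eq0[x <-//] : ab_coker_proj (y' - y) = 0.
by rewrite raddfB; apply/eqP; rewrite subr_eq0; apply/eqP; exact: reprK.
Qed.

Lemma ab_coker_desc_is_additive : zmod_morphism ab_coker_desc_fun.
Proof.
move=> x y; have [a <-] := ab_coker_proj_surj x.
have [b <-] := ab_coker_proj_surj y.
by rewrite -raddfB !ab_coker_desc_funE raddfB.
Qed.

HB.instance Definition _ := GRing.isZmodMorphism.Build ab_coker X
  ab_coker_desc_fun ab_coker_desc_is_additive.

Definition ab_coker_desc : {additive ab_coker -> X} := ab_coker_desc_fun.

Lemma ab_coker_descE y : ab_coker_desc (ab_coker_proj y) = h y.
Proof. exact: ab_coker_desc_funE. Qed.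
End Desc.
End AbCokernel.

Definition ab_exact (A B C : zmodType) (f : {additive A -> B})
    (g : {additive B -> C}) : Prop :=
  forall y, g y = 0 <-> exists x, f x = y.

Definition ab_surjective (A B : zmodType) (f : {additive A -> B}) : Prop :=
  forall y, exists x, f x = y.

Record preadditive := Preadditive {
  obj : Type;
  hom : obj -> obj -> zmodType;
  idm : forall X, hom X X;
  comp : forall X Y Z, hom Y Z -> hom X Y -> hom X Z;
  compA : forall X Y Z T (h : hom Z T) (g : hom Y Z) (f : hom X Y),
    comp h (comp g f) = comp (comp h g) f;
  comp1m : forall X Y (f : hom X Y), comp (idm Y) f = f;
  compm1 : forall X Y (f : hom X Y), comp f (idm X) = f;
  compDl : forall X Y Z (g g' : hom Y Z) (f : hom X Y),
    comp (g + g') f = comp g f + comp g' f;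
  compDr : forall X Y Z (g : hom Y Z) (f f' : hom X Y),
    comp g (f + f') = comp g f + comp g f'
}.

Arguments hom {_} _ _.
Arguments idm {_} _.
Arguments comp {_ _ _ _} _ _.

Notation "g \oc f" := (comp g f) (at level 40, left associativity).

Section CategoricalNotions.
Variable C : preadditive.

Definition mono (X Y : obj C) (f : hom X Y) : Prop :=
  forall T (g h : hom T X), f \oc g = f \oc h -> g = h.

Definition epi (X Y : obj C) (f : hom X Y) : Prop :=
  forall T (g h : hom Y T), g \oc f = h \oc f -> g = h.

Definition is_kernel (K X Y : obj C) (f : hom X Y) (k : hom K X) : Prop :=
  f \oc k = 0 /\
  forall T (h : hom T X), f \oc h = 0 -> exists! h' : hom T K, k \oc h' = h.

Definition is_cokernel (X Y Q : obj C) (f : hom X Y) (q : hom Y Q) : Prop :=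
  q \oc f = 0 /\
  forall T (h : hom Y T), h \oc f = 0 -> exists! h' : hom Q T, h' \oc q = h.

Definition is_zero_obj (Z : obj C) : Prop :=
  forall X, (forall f : hom X Z, f = 0) /\ (forall f : hom Z X, f = 0).

Definition has_biproduct (X Y : obj C) : Prop :=
  exists (S : obj C) (i1 : hom X S) (i2 : hom Y S) (p1 : hom S X) (p2 : hom S Y),
    [/\ p1 \oc i1 = idm X, p2 \oc i2 = idm Y, p1 \oc i2 = 0, p2 \oc i1 = 0
      & i1 \oc p1 + i2 \oc p2 = idm S].

Record abelian : Prop := Abelian {
  ab_zero : exists Z, is_zero_obj Z;
  ab_biproduct : forall X Y, has_biproduct X Y;
  ab_kernel : forall X Y (f : hom X Y), exists K (k : hom K X), is_kernel f k;
  ab_cokernel : forall X Y (f : hom X Y),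
    exists Q (q : hom Y Q), is_cokernel f q;
  ab_mono_normal : forall X Y (f : hom X Y), mono f ->
    exists Z (g : hom Y Z), is_kernel g f;
  ab_epi_normal : forall X Y (f : hom X Y), epi f ->
    exists Z (g : hom Z X), is_cokernel g f
}.

Definition short_exact (X Y Z : obj C) (f : hom X Y) (g : hom Y Z) : Prop :=
  is_kernel g f /\ is_cokernel f g.

Definition projective (P : obj C) : Prop :=
  forall X Y (g : hom X Y), epi g ->
  forall h : hom P Y, exists h' : hom P X, g \oc h' = h.

Definition enough_projectives : Prop :=
  forall X, exists (P : obj C) (e : hom P X), projective P /\ epi e.

End CategoricalNotions.

Section PreadditiveLemmas.
Variable C : preadditive.

Lemma comp0m (X Y Z : obj C) (f : hom X Y) : (0 : hom Y Z) \oc f = 0.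
Proof. by apply: (addrI (0 \oc f)); rewrite -compDl !addr0. Qed.

Lemma compm0 (X Y Z : obj C) (g : hom Y Z) : g \oc (0 : hom X Y) = 0.
Proof. by apply: (addrI (g \oc 0)); rewrite -compDr !addr0. Qed.

Lemma compNl (X Y Z : obj C) (g : hom Y Z) (f : hom X Y) :
  (- g) \oc f = - (g \oc f).
Proof. by apply: (addrI (g \oc f)); rewrite -compDl !subrr comp0m. Qed.

Lemma compNr (X Y Z : obj C) (g : hom Y Z) (f : hom X Y) :
  g \oc (- f) = - (g \oc f).
Proof. by apply: (addrI (g \oc f)); rewrite -compDr !subrr compm0. Qed.

Lemma compBl (X Y Z : obj C) (g g' : hom Y Z) (f : hom X Y) :
  (g - g') \oc f = g \oc f - g' \oc f.
Proof. by rewrite compDl compNl. Qed.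

Lemma compBr (X Y Z : obj C) (g : hom Y Z) (f f' : hom X Y) :
  g \oc (f - f') = g \oc f - g \oc f'.
Proof. by rewrite compDr compNr. Qed.

Lemma kernel_mono (K X Y : obj C) (f : hom X Y) (k : hom K X) :
  is_kernel f k -> mono k.
Proof.
move=> [fk0 kU] T g h kgh.
have [|u [_ uU]] := kU T (k \oc g); first by rewrite compA fk0 comp0m.
by rewrite -(uU g) // -(uU h).
Qed.
End PreadditiveLemmas.

Section Resolution.
Variable C : preadditive.

(** [syz B W i] is Omega^i B, where [W j] stands for Omega^(j+1) B. *)
Definition syz (B : obj C) (W : nat -> obj C) (i : nat) : obj C :=
  if i is j.+1 then W j else B.

(** A projective resolution of [B] together with its syzygies: exactness of
    ... -> P_1 -> P_0 -> B -> 0 is expressed by the epi-kernel factorizations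
    d_(i+1) = m_i e_(i+1) of the differentials (see [res_d]). *)
Record resolution (B : obj C) := Resolution {
  res_P : nat -> obj C;
  res_W : nat -> obj C;
  res_e : forall i, hom (res_P i) (syz B res_W i);
  res_m : forall i, hom (syz B res_W i.+1) (res_P i);
  res_proj : forall i, projective (res_P i);
  res_epi : forall i, epi (res_e i);
  res_ker : forall i, is_kernel (res_e i) (res_m i)
}.

Definition Omega (B : obj C) (R : resolution B) (i : nat) : obj C :=
  syz B (res_W R) i.

Definition res_d (B : obj C) (R : resolution B) (i : nat) :
    hom (res_P R i.+1) (res_P R i) :=
  res_m R i \oc res_e R i.+1.

Arguments res_proj {B} r i.
Arguments res_epi {B} r i.
Arguments res_ker {B} r i.

Lemma res_em0 (B : obj C) (R : resolution B) i : res_e R i \oc res_m R i = 0.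
Proof. by case: (res_ker R i). Qed.

Lemma res_dm0 (B : obj C) (R : resolution B) i :
  res_d R i \oc res_m R i.+1 = 0.
Proof. by rewrite /res_d -compA res_em0 compm0. Qed.

Lemma res_ed0 (B : obj C) (R : resolution B) i : res_e R i \oc res_d R i = 0.
Proof. by rewrite /res_d compA res_em0 comp0m. Qed.

Lemma res_dd0 (B : obj C) (R : resolution B) i :
  res_d R i \oc res_d R i.+1 = 0.
Proof. by rewrite {2}/res_d compA res_dm0 comp0m. Qed.

Section Existence.
Hypotheses (abC : abelian C) (epC : enough_projectives C).

Lemma resolution_exists (B : obj C) : inhabited (resolution B).
Proof.
have coverT X : {P : obj C & {e : hom P X | projective P /\ epi e}}.
  by have [P /cid[e ?]] := cid (epC X); exists P, e.
have kerT X Y (f : hom X Y) : {K : obj C & {k : hom K X | is_kernel f k}}.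
  by have [K /cid[k ?]] := cid (ab_kernel abC f); exists K, k.
pose P X := projT1 (coverT X); pose e X : hom (P X) X := sval (projT2 (coverT X)).
pose K X := projT1 (kerT _ _ (e X)).
pose W := fix W j := if j is i.+1 then K (W i) else K B.
pose Pi i := P (syz B W i).
have m i : {m : hom (syz B W i.+1) (Pi i) | is_kernel (e (syz B W i)) m}.
  by case: i => [|i]; exact: projT2 (kerT _ _ _).
constructor; apply: (@Resolution B Pi W (fun i => e _) (fun i => sval (m i))).
- by move=> i; have [] := svalP (projT2 (coverT (syz B W i))).
- by move=> i; have [] := svalP (projT2 (coverT (syz B W i))).
- by move=> i; exact: svalP (m i).
Qed.
End Existence.

Section Lifting.
Variables (B B' : obj C) (R : resolution B) (R' : resolution B').

Lemma lift_P_subproof i (g : hom (Omega R i) (Omega R' i)) :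
  {p : hom (res_P R i) (res_P R' i) | res_e R' i \oc p = g \oc res_e R i}.
Proof. exact/cid/(res_proj R i _ _ _ (res_epi R' i)). Qed.

Definition lift_P i g := sval (@lift_P_subproof i g).

Lemma lift_W_subproof i (g : hom (Omega R i) (Omega R' i)) :
  {w : hom (Omega R i.+1) (Omega R' i.+1) |
    res_m R' i \oc w = lift_P g \oc res_m R i}.
Proof.
apply: cid; have [_ /(_ _ (lift_P g \oc res_m R i))] := res_ker R' i.
case=> [|w [wE _]]; last by exists w.
by rewrite compA (svalP (lift_P_subproof g)) -compA res_em0 compm0.
Qed.

Variable f : hom B B'.

Fixpoint Omega_map (i : nat) : hom (Omega R i) (Omega R' i) :=
  match i with
  | 0 => f
  | j.+1 => sval (lift_W_subproof (Omega_map j))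
  end.

Definition P_map (i : nat) : hom (res_P R i) (res_P R' i) := lift_P (Omega_map i).

Lemma P_mapE i : res_e R' i \oc P_map i = Omega_map i \oc res_e R i.
Proof. exact: svalP (lift_P_subproof _). Qed.

Lemma Omega_mapE i : res_m R' i \oc Omega_map i.+1 = P_map i \oc res_m R i.
Proof. exact: svalP (lift_W_subproof _). Qed.

Lemma P_map_d i : res_d R' i \oc P_map i.+1 = P_map i \oc res_d R i.
Proof. by rewrite /res_d -compA P_mapE [LHS]compA Omega_mapE -compA. Qed.
End Lifting.

Section Homotopy.
Variables (B B' : obj C) (R : resolution B) (R' : resolution B').

Definition is_lifting (w : forall i, hom (Omega R i) (Omega R' i))
    (p : forall i, hom (res_P R i) (res_P R' i)) : Prop :=
  forall i, res_e R' i \oc p i = w i \oc res_e R i /\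
            res_m R' i \oc w i.+1 = p i \oc res_m R i.

Variables (w w' : forall i, hom (Omega R i) (Omega R' i)).
Variables (p p' : forall i, hom (res_P R i) (res_P R' i)).
Hypotheses (wp : is_lifting w p) (wp' : is_lifting w' p').
Hypothesis ww' : w 0%N = w' 0%N.

Definition through_m i : hom (Omega R i) (res_P R' i) -> Prop :=
  match i with
  | 0 => fun t => t = 0
  | j.+1 => fun t => exists s, t = s \oc res_m R j
  end.

Lemma homotopy_step i (t : hom (Omega R i) (res_P R' i)) :
  w i - w' i = res_e R' i \oc t ->
  exists s : hom (res_P R i) (res_P R' i.+1),
    p i - p' i = t \oc res_e R i + res_d R' i \oc s /\
    w i.+1 - w' i.+1 = res_e R' i.+1 \oc (s \oc res_m R i).
Proof.
move=> wt; have [_ /(_ _ (p i - p' i - t \oc res_e R i))] := res_ker R' i.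
case=> [|u [uE _]].
  by rewrite !compBr (wp i).1 (wp' i).1 -compBl wt compA subrr.
have [s sE] := res_proj R i _ _ _ (res_epi R' i.+1) u.
have pE : p i - p' i = t \oc res_e R i + res_d R' i \oc s.
  by rewrite /res_d -compA sE uE [RHS]addrC subrK.
exists s; split=> //; apply: (kernel_mono (res_ker R' i)).
rewrite compBr (wp i).2 (wp' i).2 -compBl pE compDl -compA res_em0 compm0 add0r.
by rewrite /res_d -!compA.
Qed.

Lemma lifting_homotopy i :
  exists (t : hom (Omega R i) (res_P R' i)) (s : hom (res_P R i) (res_P R' i.+1)),
    [/\ through_m t, w i - w' i = res_e R' i \oc t
      & p i - p' i = t \oc res_e R i + res_d R' i \oc s].
Proof.
suff [t [tm wt]] : exists t : hom (Omega R i) (res_P R' i),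
    through_m t /\ w i - w' i = res_e R' i \oc t.
  by have [s [ps _]] := homotopy_step wt; exists t, s.
elim: i => [|i [t [_ wt]]]; first by exists 0; rewrite ww' subrr compm0.
by have [s [_ ws]] := homotopy_step wt; exists (s \oc res_m R i); split=> //; exists s.
Qed.
End Homotopy.

Lemma Omega_map_lifting (B B' : obj C) (R : resolution B) (R' : resolution B')
  (f : hom B B') : is_lifting (Omega_map R R' f) (P_map R R' f).
Proof. by move=> i; rewrite P_mapE Omega_mapE. Qed.

Lemma id_lifting (B : obj C) (R : resolution B) :
  is_lifting (fun i => idm (Omega R i)) (fun i => idm (res_P R i)).
Proof. by move=> i; rewrite !compm1 !comp1m. Qed.

Lemma comp_lifting (B B' B'' : obj C) (R : resolution B) (R' : resolution B')
    (R'' : resolution B'') w p w' p' :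
  @is_lifting _ _ R' R'' w' p' -> @is_lifting _ _ R R' w p ->
  is_lifting (fun i => w' i \oc w i) (fun i => p' i \oc p i).
Proof.
move=> wp' wp i; split.
  by rewrite compA (wp' i).1 -!compA (wp i).1.
by rewrite compA (wp' i).2 -!compA (wp i).2.
Qed.
End Resolution.

Record functor (C : preadditive) := Functor {
  fob :> obj C -> zmodType;
  fmap : forall X Y, hom X Y -> {additive fob X -> fob Y};
  fmap1 : forall X (x : fob X), fmap (idm X) x = x;
  fmapM : forall X Y Z (g : hom Y Z) (f : hom X Y) (x : fob X),
    fmap (g \oc f) x = fmap g (fmap f x)
}.

Arguments fmap {C} _ {X Y} _.

Record additive_functor (C : preadditive) := AdditiveFunctor {
  afun :> functor C;
  fmapD : forall X Y (f g : hom X Y) (x : afun X),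
    fmap afun (f + g) x = fmap afun f x + fmap afun g x
}.

Record nat_trans (C : preadditive) (F G : functor C) := NatTrans {
  ntc :> forall X, {additive F X -> G X};
  nt_natural : forall X Y (f : hom X Y) (x : F X),
    ntc Y (fmap F f x) = fmap G f (ntc X x)
}.

Section FunctorNotions.
Variable C : preadditive.

Definition nt_monic (F G : functor C) (a : nat_trans F G) : Prop :=
  forall X, injective (a X).

Definition nt_epic (F G : functor C) (a : nat_trans F G) : Prop :=
  forall X, ab_surjective (a X).

Definition nt_iso (F G : functor C) (a : nat_trans F G) : Prop :=
  exists b : nat_trans G F, forall X, cancel (a X) (b X) /\ cancel (b X) (a X).

Definition nt_comp_zero (F G H : functor C) (a : nat_trans F G)
    (b : nat_trans G H) : Prop :=
  forall X (x : F X), b X (a X x) = 0.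

Definition nt_exact (F G H : functor C) (a : nat_trans F G)
    (b : nat_trans G H) : Prop :=
  forall X, ab_exact (a X) (b X).

Definition functor_zero (F : functor C) : Prop := forall X (x : F X), x = 0.

Definition half_exact (F : functor C) : Prop :=
  forall (X Y Z : obj C) (f : hom X Y) (g : hom Y Z),
    short_exact f g -> ab_exact (fmap F f) (fmap F g).

Definition right_exact (F : functor C) : Prop :=
  forall (X Y Z : obj C) (f : hom X Y) (g : hom Y Z), short_exact f g ->
    ab_exact (fmap F f) (fmap F g) /\ ab_surjective (fmap F g).

Definition mono_preserving (F : functor C) : Prop :=
  forall (X Y : obj C) (f : hom X Y), mono f -> injective (fmap F f).

Definition epi_preserving (F : functor C) : Prop :=
  forall (X Y : obj C) (f : hom X Y), epi f -> ab_surjective (fmap F f).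
End FunctorNotions.

Section AdditiveFunctorLemmas.
Variables (C : preadditive) (F : additive_functor C).

Lemma fmap0 (X Y : obj C) (x : F X) : fmap F (0 : hom X Y) x = 0.
Proof. by apply: (addrI (fmap F 0 x)); rewrite -fmapD !addr0. Qed.

Lemma fmapN (X Y : obj C) (f : hom X Y) (x : F X) :
  fmap F (- f) x = - fmap F f x.
Proof. by apply: (addrI (fmap F f x)); rewrite -fmapD !subrr fmap0. Qed.

Lemma fmapB (X Y : obj C) (f g : hom X Y) (x : F X) :
  fmap F (f - g) x = fmap F f x - fmap F g x.
Proof. by rewrite fmapD fmapN. Qed.
End AdditiveFunctorLemmas.

Section FundamentalSequence.
Variables (C : preadditive) (F : additive_functor C).
Variable res : forall B : obj C, resolution B.

Section Uniqueness.
Variables (B B' : obj C).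
Let R := res B.
Let R' := res B'.
Variables (w w' : forall i, hom (Omega R i) (Omega R' i)).
Variables (p p' : forall i, hom (res_P R i) (res_P R' i)).
Hypotheses (wp : is_lifting w p) (wp' : is_lifting w' p').
Hypothesis ww' : w 0%N = w' 0%N.

Lemma lifting_Omega_coker i (x : F (Omega R i)) :
  ab_coker_proj (fmap F (res_e R' i)) (fmap F (w i) x) =
  ab_coker_proj (fmap F (res_e R' i)) (fmap F (w' i) x).
Proof.
apply/eqP; rewrite -subr_eq0 -raddfB -fmapB; apply/eqP/ab_coker_proj_eq0.
have [t [s [_ -> _]]] := lifting_homotopy wp wp' ww' i.
by exists (fmap F t x); rewrite fmapM.
Qed.

Lemma lifting_Omega_ker j (x : F (Omega R j.+1)) :
  fmap F (res_m R j) x = 0 -> fmap F (w j.+1) x = fmap F (w' j.+1) x.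
Proof.
move=> mx; apply/eqP; rewrite -subr_eq0 -fmapB; apply/eqP.
have [t [s [[u ->] -> _]]] := lifting_homotopy wp wp' ww' j.+1.
by rewrite !fmapM mx !raddf0.
Qed.
End Uniqueness.

(** [sat_ob j] is the object part of the satellite S_(j+1) F. *)
Definition sat_ob (j : nat) (B : obj C) : zmodType :=
  ab_ker (fmap F (res_m (res B) j)).

Definition sat_incl j B : {additive sat_ob j B -> F (Omega (res B) j.+1)} :=
  ab_ker_incl (fmap F (res_m (res B) j)).

Lemma sat_map_subproof j B B' (f : hom B B') (x : sat_ob j B) :
  fmap F (res_m (res B') j)
    (fmap F (Omega_map (res B) (res B') f j.+1) (sat_incl j B x)) = 0.
Proof. by rewrite -fmapM Omega_mapE fmapM ab_ker_inclP raddf0. Qed.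

Definition sat_map j B B' (f : hom B B') : {additive sat_ob j B -> sat_ob j B'} :=
  ab_ker_lift
    (h := fmap F (Omega_map (res B) (res B') f j.+1) \o sat_incl j B)
    (sat_map_subproof f).

Lemma sat_mapE j B B' (f : hom B B') (x : sat_ob j B) :
  sat_incl j B' (sat_map j f x) =
  fmap F (Omega_map (res B) (res B') f j.+1) (sat_incl j B x).
Proof. by []. Qed.

Lemma sat_map1 j B (x : sat_ob j B) : sat_map j (idm B) x = x.
Proof.
apply: ab_ker_incl_inj; rewrite [LHS]sat_mapE.
rewrite (lifting_Omega_ker (Omega_map_lifting _ _ _) (id_lifting _)) ?fmap1 //.
exact: ab_ker_inclP.
Qed.

Lemma sat_mapM j B B' B'' (g : hom B' B'') (f : hom B B') (x : sat_ob j B) :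
  sat_map j (g \oc f) x = sat_map j g (sat_map j f x).
Proof.
apply: ab_ker_incl_inj; rewrite [LHS]sat_mapE [RHS]sat_mapE sat_mapE -fmapM.
apply: (lifting_Omega_ker (Omega_map_lifting _ _ _)
  (comp_lifting (Omega_map_lifting _ _ _) (Omega_map_lifting _ _ _))) => //.
exact: ab_ker_inclP.
Qed.

Definition satellite (i : nat) : functor C :=
  match i with
  | 0 => F
  | j.+1 => Functor (@sat_map1 j) (@sat_mapM j)
  end.

(** [qs_ob i B] is the quot-stabilization of F at Omega^i B: since Omega^i B is
    covered by e_i : P_i -> Omega^i B, this is Coker F(e_i). *)
Definition qs_ob (i : nat) (B : obj C) : zmodType :=
  ab_coker (fmap F (res_e (res B) i)).

Definition qs_proj i B : {additive F (Omega (res B) i) -> qs_ob i B} :=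
  ab_coker_proj (fmap F (res_e (res B) i)).

Lemma qs_map_subproof i B B' (f : hom B B') (x : F (res_P (res B) i)) :
  qs_proj i B' (fmap F (Omega_map (res B) (res B') f i)
    (fmap F (res_e (res B) i) x)) = 0.
Proof.
apply/ab_coker_proj_eq0; exists (fmap F (P_map (res B) (res B') f i) x).
by rewrite -!fmapM P_mapE.
Qed.

Definition qs_map i B B' (f : hom B B') : {additive qs_ob i B -> qs_ob i B'} :=
  ab_coker_desc (h := qs_proj i B' \o fmap F (Omega_map (res B) (res B') f i))
    (qs_map_subproof f).

Lemma qs_mapE i B B' (f : hom B B') (x : F (Omega (res B) i)) :
  qs_map i f (qs_proj i B x) =
  qs_proj i B' (fmap F (Omega_map (res B) (res B') f i) x).
Proof. by rewrite /qs_map ab_coker_descE. Qed.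

Lemma qs_map1 i B (x : qs_ob i B) : qs_map i (idm B) x = x.
Proof.
have [y <-] := ab_coker_proj_surj x; rewrite qs_mapE.
rewrite /qs_proj (lifting_Omega_coker (Omega_map_lifting _ _ _) (id_lifting _)) //.
by rewrite fmap1.
Qed.

Lemma qs_mapM i B B' B'' (g : hom B' B'') (f : hom B B') (x : qs_ob i B) :
  qs_map i (g \oc f) x = qs_map i g (qs_map i f x).
Proof.
have [y <-] := ab_coker_proj_surj x; rewrite [LHS]qs_mapE [X in qs_map _ _ X]qs_mapE.
rewrite [RHS]qs_mapE -fmapM.
exact: (lifting_Omega_coker (Omega_map_lifting (res B) (res B'') (g \oc f))
  (comp_lifting (Omega_map_lifting (res B') (res B'') g)
     (Omega_map_lifting _ _ f)) erefl y).
Qed.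

Definition quot_stab (i : nat) : functor C := Functor (@qs_map1 i) (@qs_mapM i).

(** [cyc_ob i B] is Ker F(d_i), with the convention Ker F(d_0) = F(P_0). *)
Definition cyc_ob (i : nat) (B : obj C) : zmodType :=
  match i with
  | 0 => F (res_P (res B) 0)
  | j.+1 => ab_ker (fmap F (res_d (res B) j))
  end.

Definition cyc_incl i B : {additive cyc_ob i B -> F (res_P (res B) i)} :=
  match i return {additive cyc_ob i B -> F (res_P (res B) i)} with
  | 0 => idfun
  | j.+1 => ab_ker_incl (fmap F (res_d (res B) j))
  end.

Definition is_cyc i B : F (res_P (res B) i) -> Prop :=
  match i return F (res_P (res B) i) -> Prop with
  | 0 => fun=> True
  | j.+1 => fun x => fmap F (res_d (res B) j) x = 0
  end.

Lemma cyc_inclP i B (z : cyc_ob i B) : is_cyc (cyc_incl i B z).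
Proof. by case: i z => [|j] z //=; exact: ab_ker_inclP. Qed.

Lemma cyc_incl_inj i B : injective (cyc_incl i B).
Proof. by case: i => [|j] //=; exact: ab_ker_incl_inj. Qed.

Definition cyc_lift i B (X : zmodType) :
    forall h : {additive X -> F (res_P (res B) i)},
    (forall x, is_cyc (h x)) -> {additive X -> cyc_ob i B} :=
  match i return forall h : {additive X -> F (res_P (res B) i)},
    (forall x, is_cyc (h x)) -> {additive X -> cyc_ob i B} with
  | 0 => fun h _ => h
  | j.+1 => fun h h0 => ab_ker_lift h0
  end.

Lemma cyc_liftE i B (X : zmodType) (h : {additive X -> F (res_P (res B) i)})
  (h0 : forall x, is_cyc (h x)) x : cyc_incl i B (cyc_lift h0 x) = h x.
Proof. by case: i h h0. Qed.

Lemma bd_subproof i B (x : F (res_P (res B) i.+1)) :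
  is_cyc (fmap F (res_d (res B) i) x).
Proof. by case: i x => [|j] x //=; rewrite -fmapM res_dd0 fmap0. Qed.

Definition bd i B : {additive F (res_P (res B) i.+1) -> cyc_ob i B} :=
  cyc_lift (@bd_subproof i B).

Definition L_ob (i : nat) (B : obj C) : zmodType := ab_coker (bd i B).

Definition L_proj i B : {additive cyc_ob i B -> L_ob i B} := ab_coker_proj (bd i B).

Lemma cyc_map_subproof i B B' (f : hom B B') (z : cyc_ob i B) :
  is_cyc (fmap F (P_map (res B) (res B') f i) (cyc_incl i B z)).
Proof.
case: i z => [|j] z //=.
by rewrite -fmapM P_map_d fmapM ab_ker_inclP raddf0.
Qed.

Definition cyc_map i B B' (f : hom B B') : {additive cyc_ob i B -> cyc_ob i B'} :=
  cyc_lift (h := fmap F (P_map (res B) (res B') f i) \o cyc_incl i B)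
    (cyc_map_subproof f).

Lemma cyc_mapE i B B' (f : hom B B') (z : cyc_ob i B) :
  cyc_incl i B' (cyc_map i f z) =
  fmap F (P_map (res B) (res B') f i) (cyc_incl i B z).
Proof. exact: cyc_liftE. Qed.

Lemma L_map_subproof i B B' (f : hom B B') (x : F (res_P (res B) i.+1)) :
  L_proj i B' (cyc_map i f (bd i B x)) = 0.
Proof.
apply/ab_coker_proj_eq0; exists (fmap F (P_map (res B) (res B') f i.+1) x).
apply: cyc_incl_inj; rewrite cyc_mapE /bd !cyc_liftE -!fmapM.
by rewrite P_map_d.
Qed.

Definition L_map i B B' (f : hom B B') : {additive L_ob i B -> L_ob i B'} :=
  ab_coker_desc (h := L_proj i B' \o cyc_map i f) (L_map_subproof f).

Lemma L_mapE i B B' (f : hom B B') (z : cyc_ob i B) :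
  L_map i f (L_proj i B z) = L_proj i B' (cyc_map i f z).
Proof. by rewrite /L_map ab_coker_descE. Qed.

Lemma lifting_L i B B' w w' p p' (z : cyc_ob i B) (z1 z2 : cyc_ob i B') :
  @is_lifting _ _ _ (res B) (res B') w p -> is_lifting w' p' ->
  w 0%N = w' 0%N ->
  cyc_incl i B' z1 = fmap F (p i) (cyc_incl i B z) ->
  cyc_incl i B' z2 = fmap F (p' i) (cyc_incl i B z) ->
  L_proj i B' z1 = L_proj i B' z2.
Proof.
move=> wp wp' ww' z1E z2E; apply/eqP; rewrite -subr_eq0 -raddfB.
apply/eqP/ab_coker_proj_eq0.
have [t [s [tm _ pp']]] := lifting_homotopy wp wp' ww' i.
exists (fmap F s (cyc_incl i B z)); apply: cyc_incl_inj.
rewrite cyc_liftE raddfB z1E z2E -fmapB pp' fmapD [X in _ + X]fmapM.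
suff -> : fmap F (t \oc res_e (res B) i) (cyc_incl i B z) = 0 by rewrite add0r.
have := cyc_inclP z.
case: i t tm {pp' s z1 z2 z1E z2E} z => [|j] t /= tm z.
  by rewrite tm comp0m fmap0.
by case: tm => u -> dz; rewrite -compA fmapM dz raddf0.
Qed.

Lemma L_map1 i B (x : L_ob i B) : L_map i (idm B) x = x.
Proof.
have [z <-] := ab_coker_proj_surj x; rewrite L_mapE.
apply: (lifting_L (z := z) (Omega_map_lifting _ _ (idm B)) (id_lifting _)) => //.
  exact: cyc_mapE.
by rewrite fmap1.
Qed.

Lemma L_mapM i B B' B'' (g : hom B' B'') (f : hom B B') (x : L_ob i B) :
  L_map i (g \oc f) x = L_map i g (L_map i f x).
Proof.
have [z <-] := ab_coker_proj_surj x; rewrite [LHS]L_mapE [X in L_map _ _ X]L_mapE.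
rewrite [RHS]L_mapE.
apply: (lifting_L (z := z) (Omega_map_lifting _ _ (g \oc f))
  (comp_lifting (Omega_map_lifting _ _ g) (Omega_map_lifting _ _ f))) => //.
  exact: cyc_mapE.
by rewrite !cyc_mapE fmapM.
Qed.

Definition left_derived (i : nat) : functor C := Functor (@L_map1 i) (@L_mapM i).

Lemma lambda_subproof B (x : F (res_P (res B) 1)) :
  fmap F (res_e (res B) 0) (cyc_incl 0 B (bd 0 B x)) = 0.
Proof. by rewrite cyc_liftE -fmapM res_ed0 fmap0. Qed.

Definition lambda_map B : {additive L_ob 0 B -> F B} :=
  ab_coker_desc (h := fmap F (res_e (res B) 0) \o cyc_incl 0 B)
    (@lambda_subproof B).

Lemma lambda_mapE B (z : cyc_ob 0 B) :
  lambda_map B (L_proj 0 B z) = fmap F (res_e (res B) 0) z.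
Proof. by rewrite /lambda_map /L_proj ab_coker_descE. Qed.

Lemma lambda_natural B B' (f : hom B B') (x : left_derived 0 B) :
  lambda_map B' (fmap (left_derived 0) f x) = fmap F f (lambda_map B x).
Proof.
have [z <-] := ab_coker_proj_surj x; rewrite [fmap _ f _]L_mapE.
rewrite [LHS]lambda_mapE [X in fmap _ f X]lambda_mapE.
by rewrite [cyc_map _ _ _](cyc_mapE (i := 0)) -!fmapM P_mapE.
Qed.

Lemma L_to_sat_cyc_subproof j B (z : cyc_ob j.+1 B) :
  fmap F (res_m (res B) j) (fmap F (res_e (res B) j.+1) (cyc_incl j.+1 B z)) = 0.
Proof. by rewrite -fmapM; exact: (cyc_inclP z). Qed.

Definition L_to_sat_cyc j B : {additive cyc_ob j.+1 B -> sat_ob j B} :=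
  ab_ker_lift (h := fmap F (res_e (res B) j.+1) \o cyc_incl j.+1 B)
    (@L_to_sat_cyc_subproof j B).

Lemma L_to_sat_cycE j B (z : cyc_ob j.+1 B) :
  sat_incl j B (L_to_sat_cyc j B z) =
  fmap F (res_e (res B) j.+1) (cyc_incl j.+1 B z).
Proof. by []. Qed.

Lemma L_to_sat_subproof j B (x : F (res_P (res B) j.+2)) :
  L_to_sat_cyc j B (bd j.+1 B x) = 0.
Proof.
apply: ab_ker_incl_inj; rewrite ab_ker_liftE raddf0 /=.
by rewrite -fmapM res_ed0 fmap0.
Qed.

Definition L_to_sat_map j B : {additive L_ob j.+1 B -> sat_ob j B} :=
  ab_coker_desc (@L_to_sat_subproof j B).

Lemma L_to_sat_mapE j B (z : cyc_ob j.+1 B) :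
  L_to_sat_map j B (L_proj j.+1 B z) = L_to_sat_cyc j B z.
Proof. by rewrite /L_to_sat_map /L_proj ab_coker_descE. Qed.

Lemma L_to_sat_natural j B B' (f : hom B B') (x : left_derived j.+1 B) :
  L_to_sat_map j B' (fmap (left_derived j.+1) f x) =
  fmap (satellite j.+1) f (L_to_sat_map j B x).
Proof.
have [z <-] := ab_coker_proj_surj x; rewrite [fmap _ f _]L_mapE.
rewrite [LHS]L_to_sat_mapE [X in fmap _ f X]L_to_sat_mapE.
apply: ab_ker_incl_inj; rewrite [LHS]L_to_sat_cycE [RHS]sat_mapE.
by rewrite (cyc_mapE (i := j.+1)) L_to_sat_cycE -!fmapM P_mapE.
Qed.

Definition L_to_S (i : nat) : nat_trans (left_derived i) (satellite i) :=
  match i return nat_trans (left_derived i) (satellite i) with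
  | 0 => @NatTrans C (left_derived 0) F lambda_map lambda_natural
  | j.+1 => @NatTrans C (left_derived j.+1) (satellite j.+1) (L_to_sat_map j)
      (@L_to_sat_natural j)
  end.

Definition lambda : nat_trans (left_derived 0) F := L_to_S 0.

Definition S_incl i B : {additive satellite i B -> F (Omega (res B) i)} :=
  match i return {additive satellite i B -> F (Omega (res B) i)} with
  | 0 => idfun
  | j.+1 => sat_incl j B
  end.

Definition S_to_Q_map i B : {additive satellite i B -> quot_stab i B} :=
  qs_proj i B \o S_incl i B.

Lemma S_to_Q_natural i B B' (f : hom B B') (x : satellite i B) :
  S_to_Q_map i B' (fmap (satellite i) f x) =
  fmap (quot_stab i) f (S_to_Q_map i B x).
Proof. by rewrite [RHS]qs_mapE; case: i x. Qed.

Definition S_to_Q (i : nat) : nat_trans (satellite i) (quot_stab i) :=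
  @NatTrans C (satellite i) (quot_stab i) (S_to_Q_map i) (@S_to_Q_natural i).

Lemma Q_to_L_cyc_subproof i B (x : F (Omega (res B) i.+1)) :
  is_cyc (fmap F (res_m (res B) i) x).
Proof. by case: i x => [|j] x //=; rewrite -fmapM res_dm0 fmap0. Qed.

Definition Q_to_L_cyc i B : {additive F (Omega (res B) i.+1) -> cyc_ob i B} :=
  cyc_lift (@Q_to_L_cyc_subproof i B).

Lemma Q_to_L_subproof i B (x : F (res_P (res B) i.+1)) :
  L_proj i B (Q_to_L_cyc i B (fmap F (res_e (res B) i.+1) x)) = 0.
Proof.
apply/ab_coker_proj_eq0; exists x; apply: cyc_incl_inj.
by rewrite !cyc_liftE -fmapM.
Qed.

Definition Q_to_L_map i B : {additive quot_stab i.+1 B -> left_derived i B} :=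
  ab_coker_desc (h := L_proj i B \o Q_to_L_cyc i B) (@Q_to_L_subproof i B).

Lemma Q_to_L_mapE i B (x : F (Omega (res B) i.+1)) :
  Q_to_L_map i B (qs_proj i.+1 B x) = L_proj i B (Q_to_L_cyc i B x).
Proof. by rewrite /Q_to_L_map /qs_proj ab_coker_descE. Qed.

Lemma Q_to_L_natural i B B' (f : hom B B') (x : quot_stab i.+1 B) :
  Q_to_L_map i B' (fmap (quot_stab i.+1) f x) =
  fmap (left_derived i) f (Q_to_L_map i B x).
Proof.
have [y <-] := ab_coker_proj_surj x.
rewrite [fmap (quot_stab _) f _]qs_mapE [LHS]Q_to_L_mapE.
rewrite [X in fmap _ f X]Q_to_L_mapE [RHS]L_mapE; congr (L_proj i B' _); apply: cyc_incl_inj.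
by rewrite cyc_mapE !cyc_liftE -!fmapM Omega_mapE.
Qed.

Definition Q_to_L (i : nat) : nat_trans (quot_stab i.+1) (left_derived i) :=
  @NatTrans C (quot_stab i.+1) (left_derived i) (Q_to_L_map i)
    (@Q_to_L_natural i).

Definition alpha : nat_trans (quot_stab 1) (left_derived 0) := Q_to_L 0.

Definition fundamental_complex : Prop :=
  forall i, [/\ nt_comp_zero (L_to_S i) (S_to_Q i),
                nt_comp_zero (S_to_Q i.+1) (Q_to_L i)
              & nt_comp_zero (Q_to_L i) (L_to_S i)].

Definition exact_at_satellites : Prop :=
  forall i, nt_exact (L_to_S i) (S_to_Q i).

(** The last term of the sequence is [quot_stab 0], followed by 0. *)
Definition exact_at_quot_stabs : Prop :=
  nt_epic (S_to_Q 0) /\ forall i, nt_exact (S_to_Q i.+1) (Q_to_L i).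

Definition exact_at_left_derived : Prop :=
  forall i, nt_exact (Q_to_L i) (L_to_S i).

End FundamentalSequence.

(* Main.v *)
(** Writing every term through one resolution, each exactness claim is a chase
    based on [F(d_i) = F(m_i) F(e_(i+1))].  Half-exactness enters only at [L_i F],
    through the short exact sequences [Omega^(i+1) B -> P_i -> Omega^i B].

    For the converse half of (5), let [lambda] be an isomorphism and [f : X ->
    Y] a kernel of the epimorphism [g : Y -> Z]. Write [e_Y], [e_Z] for the
    chosen epimorphisms from projectives and [m_Z] for the kernel of [e_Z];
    choose [a], [b] with [e_Z a = g e_Y] and [g b = e_Z]. Then [e_Y - b a] and
    [b m_Z] are annihilated by [g], hence factor through [f]. If [F(g)] kills [y
    = F(e_Y) p], then [F(a) p] is some [F(m_Z) s], and [y = F(e_Y - b a) p + F(b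
    m_Z) s] lies in the image of [F(f)]. *)

From HB Require Import structures.
From mathcomp Require Import all_boot all_algebra.
From mathcomp Require Import boolp.
Require Import Defs.

Set Implicit Arguments.
Unset Strict Implicit.
Unset Printing Implicit Defensive.

Import GRing.Theory.
Local Open Scope ring_scope.

Lemma ab_bijective_inverse (A B : zmodType) (f : {additive A -> B}) :
  injective f -> ab_surjective f ->
  {g : {additive B -> A} | cancel f g /\ cancel g f}.
Proof.
move=> f_inj f_surj.
pose g y := sval (cid (f_surj y)).
have gK : cancel g f by move=> y; exact: svalP (cid (f_surj y)).
have g_additive : zmod_morphism g.
  by move=> x y; apply: f_inj; rewrite raddfB !gK.
pose gM := GRing.isZmodMorphism.Build B A g g_additive.
pose G : {additive B -> A} := HB.pack g gM.
by exists G; split=> [x|]; [apply: f_inj; exact: gK | exact: gK].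
Qed.

Lemma ab_coker_proj_image (A B : zmodType) (f : {additive A -> B}) x :
  ab_coker_proj f (f x) = 0.
Proof. by apply/ab_coker_proj_eq0; exists x. Qed.

Section AbelianCategory.
Variable C : preadditive.
Hypothesis abC : abelian C.

(** By normality [e] is a cokernel of some [g], and [g] factors through [k]. A map that kills [k]
    therefore kills [g] and descends along [e]. *)
Lemma epi_short_exact (K X Y : obj C) (k : hom K X) (e : hom X Y) :
  epi e -> is_kernel e k -> short_exact k e.
Proof.
move=> e_epi k_ker; split=> //; case: (k_ker) => ek0 kU; split=> // T h hk0.
have [W [g [eg0 gU]]] := ab_epi_normal abC e_epi.
have [u [uE _]] := kU W g eg0.
by apply: gU; rewrite -uE compA hk0 comp0m.
Qed.

Lemma right_exact_epi_preserving (F : functor C) :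
  right_exact F -> epi_preserving F.
Proof.
move=> F_rex X Y e e_epi; have [K [k k_ker]] := ab_kernel abC e.
by have [] := F_rex _ _ _ _ _ (epi_short_exact e_epi k_ker).
Qed.

End AbelianCategory.

Lemma cokernel_epi (C : preadditive) (X Y Q : obj C) (f : hom X Y) (q : hom Y Q) :
  is_cokernel f q -> epi q.
Proof.
move=> [qf0 qU] T g h gq_hq.
have [|u [_ uU]] := qU T (g \oc q); first by rewrite -compA qf0 compm0.
by rewrite -(uU g) // -(uU h).
Qed.

(** The componentwise inverses are additive and natural because both laws can be checked after
    applying the injective components of [a]. *)
Lemma nt_iso_bijective (C : preadditive) (F G : functor C) (a : nat_trans F G) :
  nt_iso a <-> nt_monic a /\ nt_epic a.
Proof.
split=> [[b bK]|[a_inj a_surj]].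
  split=> X; first exact: can_inj (bK X).1.
  by move=> y; exists (b X y); exact: (bK X).2.
pose b X := sval (ab_bijective_inverse (a_inj X) (a_surj X)).
have bK X : cancel (a X) (b X) /\ cancel (b X) (a X).
  exact: svalP (ab_bijective_inverse (a_inj X) (a_surj X)).
have b_nat X Y (f : hom X Y) (y : G X) : b Y (fmap G f y) = fmap F f (b X y).
  by apply: (a_inj Y); rewrite (bK Y).2 nt_natural (bK X).2.
by exists (NatTrans b_nat).
Qed.

Section FundamentalSequence.
Variables (C : preadditive) (F : additive_functor C).
Variable res : forall B : obj C, resolution B.

Lemma fmap_res_d B i (x : F (res_P (res B) i.+1)) :
  fmap F (res_d (res B) i) x =
  fmap F (res_m (res B) i) (fmap F (res_e (res B) i.+1) x).
Proof. exact: fmapM. Qed.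

Lemma L_proj_eq0 i B (z : cyc_ob F res i B) :
  L_proj F res i B z = 0 <->
  exists p, fmap F (res_d (res B) i) p = cyc_incl F res i B z.
Proof.
split=> [/ab_coker_proj_eq0[p <-]|[p pE]]; first by exists p; rewrite cyc_liftE.
by apply/ab_coker_proj_eq0; exists p; apply: cyc_incl_inj; rewrite cyc_liftE.
Qed.

Lemma Q_to_L_eq0 i B (x : F (Omega (res B) i.+1)) :
  Q_to_L_map F res i B (qs_proj F res i.+1 B x) = 0 <->
  exists p, fmap F (res_m (res B) i) (fmap F (res_e (res B) i.+1) p) =
            fmap F (res_m (res B) i) x.
Proof.
rewrite Q_to_L_mapE; split=> [/L_proj_eq0[p]|[p pE]].
  by rewrite cyc_liftE fmap_res_d => pE; exists p.
by apply/L_proj_eq0; exists p; rewrite cyc_liftE fmap_res_d.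
Qed.

(** Treats [lambda] ([i = 0]) and the maps into the higher satellites uniformly, as the effect of
    [F(e_i)] on cycles. *)
Lemma S_incl_L_to_S i B (z : cyc_ob F res i B) :
  S_incl F res i B (L_to_S F res i B (L_proj F res i B z)) =
  fmap F (res_e (res B) i) (cyc_incl F res i B z).
Proof.
case: i z => [|j] z; first exact: lambda_mapE.
by rewrite [L_to_S _ _ _ _ _]L_to_sat_mapE.
Qed.

Lemma S_incl_inj i B : injective (S_incl F res i B).
Proof. by case: i => [|j] //=; exact: ab_ker_incl_inj. Qed.

Lemma fundamental_sequence_complex : fundamental_complex F res.
Proof.
move=> i; split=> B x.
- have [z <-] := ab_coker_proj_surj x.
  rewrite /= /S_to_Q_map /= S_incl_L_to_S; exact: ab_coker_proj_image.
(* The witness 0 works because [x] already lies in Ker [F(m_i)]. *)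
- apply/Q_to_L_eq0; exists 0.
  by rewrite !raddf0 ab_ker_inclP.
- have [y <-] := ab_coker_proj_surj x.
  apply: S_incl_inj; rewrite [Q_to_L _ _ _ _ _]Q_to_L_mapE S_incl_L_to_S raddf0.
  by rewrite cyc_liftE -fmapM res_em0 fmap0.
Qed.

Lemma fundamental_sequence_exact_at_satellites : exact_at_satellites F res.
Proof.
move=> i B x; split=> [|[y <-]]; last by have [] := fundamental_sequence_complex i.
move=> /ab_coker_proj_eq0[p pE].
(* For [i = j+1], [F(d_j) p = F(m_j) F(e_(j+1)) p], which is [F(m_j)] applied to an element of the
   satellite; for [i = 0] there is no condition. *)
have p_cyc : is_cyc p.
  case: i x p pE => [|j] x p //= pE.
  by rewrite fmap_res_d pE ab_ker_inclP.
have [z zE] : exists z : cyc_ob F res i B, cyc_incl F res i B z = p.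
  case: i {x pE} p p_cyc => [|j] p p_cyc; first by exists p.
  by exists (AbKer (introT eqP p_cyc)).
by exists (L_proj F res i B z); apply: S_incl_inj; rewrite S_incl_L_to_S zE.
Qed.

Lemma fundamental_sequence_exact_at_quot_stabs : exact_at_quot_stabs F res.
Proof.
split=> [B y|i B y]; first exact: ab_coker_proj_surj.
split=> [|[x <-]]; last by have [] := fundamental_sequence_complex i.
have [x <-] := ab_coker_proj_surj y => /Q_to_L_eq0[p pE].
(* Subtracting an element of Im [F(e_(i+1))] keeps the class of [x] and moves [x] into the
   satellite. *)
have x_ker : x - fmap F (res_e (res B) i.+1) p
    \in ab_ker_pred (fmap F (res_m (res B) i)).
  by apply/eqP; rewrite raddfB pE subrr.
exists (AbKer x_ker); rewrite /= /S_to_Q_map /= raddfB.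
by rewrite [X in _ - X]ab_coker_proj_image subr0.
Qed.

Lemma half_exact_exact_at_left_derived :
  abelian C -> half_exact F -> exact_at_left_derived F res.
Proof.
move=> abC F_hex i B y.
split=> [|[x <-]]; last by have [] := fundamental_sequence_complex i.
have [z <-] := ab_coker_proj_surj y => Lz0.
have /F_hex me_exact :=
  epi_short_exact abC (res_epi (r := res B) (i := i)) (res_ker (res B) i).
have /me_exact[x xE] : fmap F (res_e (res B) i) (cyc_incl F res i B z) = 0.
  by rewrite -S_incl_L_to_S Lz0 raddf0.
exists (qs_proj F res i.+1 B x); rewrite [LHS]Q_to_L_mapE.
by congr (L_proj _ _ _ _ _); apply: cyc_incl_inj; rewrite cyc_liftE.
Qed.

(** Cancelling the injective [F(m_0)] in [F(m_0) F(e_1) p = F(m_0) x] puts [x] in Im [F(e_1)], so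
    its class is zero. *)
Lemma mono_preserving_alpha_monic :
  mono_preserving F -> nt_monic (alpha F res).
Proof.
move=> F_mono B; apply: raddf_inj => y.
have [x <-] := ab_coker_proj_surj y => /Q_to_L_eq0[p].
move=> /(F_mono _ _ _ (kernel_mono (res_ker (res B) 0))) <-.
exact: ab_coker_proj_image.
Qed.

(** [L_proj] is onto, so [lambda] and [F(e_0)] have the same image. *)
Lemma nt_epic_lambda :
  nt_epic (lambda F res) <->
  forall B, ab_surjective (fmap F (res_e (res B) 0)).
Proof.
split=> [l_surj B y|e_surj B y].
  have [x <-] := l_surj B y; have [z <-] := ab_coker_proj_surj x.
  by exists z; rewrite [RHS]lambda_mapE.
have [z <-] := e_surj B y.
by exists (L_proj F res 0 B z); exact: lambda_mapE.
Qed.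

Lemma epi_preserving_quot_stab_zero :
  epi_preserving F -> functor_zero (quot_stab F res 0).
Proof.
move=> F_epi B y; have [x <-] := ab_coker_proj_surj y.
have [p <-] := F_epi _ _ _ (res_epi (r := res B) (i := 0)) x.
exact: ab_coker_proj_image.
Qed.

Lemma epi_preserving_lambda_epic :
  epi_preserving F -> nt_epic (lambda F res).
Proof.
by move=> F_epi; apply/nt_epic_lambda => B; apply: F_epi; exact: res_epi.
Qed.

Lemma right_exact_lambda_iso :
  abelian C -> right_exact F -> nt_iso (lambda F res).
Proof.
move=> abC F_rex; have F_epi := right_exact_epi_preserving abC F_rex.
apply/nt_iso_bijective; split; last exact: epi_preserving_lambda_epic.
move=> B; apply: raddf_inj => y; have [z <-] := ab_coker_proj_surj y => lz0.
have [me_exact _] := F_rex _ _ _ _ _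
  (epi_short_exact abC (res_epi (r := res B) (i := 0)) (res_ker (res B) 0)).
have /me_exact[x xE] : fmap F (res_e (res B) 0) z = 0.
  by rewrite -lz0 [RHS]lambda_mapE.
(* Lifting [x] along [F(e_1)] turns [z = F(m_0) x] into the boundary [F(m_0 e_1) p]. *)
have [p pE] := F_epi _ _ _ (res_epi (r := res B) (i := 1)) x.
by apply/L_proj_eq0; exists p; rewrite fmap_res_d pE.
Qed.

Lemma lambda_iso_right_exact : nt_iso (lambda F res) -> right_exact F.
Proof.
move=> /nt_iso_bijective[l_inj /nt_epic_lambda e_surj] X Y Z f g.
move=> [[gf0 fU] /cokernel_epi g_epi].
have [b bE] := res_proj (r := res Z) (i := 0) g_epi (res_e (res Z) 0).
split=> [y|z]; last first.
  (* Surjectivity of [F(g)] follows from that of [F(e_Z) = F(g) F(b)]. *)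
  by have [p <-] := e_surj Z z; exists (fmap F b p); rewrite -fmapM bE.
split=> [gy0|[x <-]]; last by rewrite -fmapM gf0 fmap0.
have [p pE] := e_surj Y y.
have [a aE] := res_proj (r := res Y) (i := 0) (res_epi (r := res Z) (i := 0))
  (g \oc res_e (res Y) 0).
(* [lambda] sends this class to [F(e_Z a) p = F(g) F(e_Y) p = F(g) y = 0]. *)
have : L_proj F res 0 Z (fmap F a p) = 0.
  apply: l_inj; rewrite raddf0 [LHS]lambda_mapE.
  by rewrite -[LHS]fmapM aE fmapM pE.
move=> /L_proj_eq0[q]; rewrite fmap_res_d /=; move: (fmap F (res_e _ _) q) => s sE.
have [|t [tE _]] := fU _ (res_e (res Y) 0 - b \oc a).
  by rewrite compBr compA bE aE subrr.
have [|v [vE _]] := fU _ (b \oc res_m (res Z) 0).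
  by rewrite compA bE res_em0.
(* The image is [F(e_Y) p - F(b a) p + F(b m_Z) s]; the last two terms cancel since
   [F(m_Z) s = F(a) p]. *)
exists (fmap F t p + fmap F v s).
rewrite raddfD -!fmapM tE vE fmapB [fmap F (b \oc res_m _ _) s]fmapM.
by rewrite sE -fmapM subrK.
Qed.

End FundamentalSequence.

Theorem theorem6p2 (C : preadditive) (abC : abelian C)
    (epC : enough_projectives C) (F : additive_functor C)
    (res : forall B : obj C, resolution B) :
  (fundamental_complex F res /\
   exact_at_satellites F res /\ exact_at_quot_stabs F res) /\
  (half_exact F ->
   exact_at_satellites F res /\ exact_at_quot_stabs F res /\
   exact_at_left_derived F res) /\
  (mono_preserving F -> nt_monic (alpha F res)) /\
  (epi_preserving F ->
   functor_zero (quot_stab F res 0) /\ nt_epic (lambda F res)) /\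
  (nt_iso (lambda F res) <-> right_exact F).
Proof.
have sat_exact : exact_at_satellites F res.
  exact: fundamental_sequence_exact_at_satellites.
have quot_exact : exact_at_quot_stabs F res.
  exact: fundamental_sequence_exact_at_quot_stabs.
split; first by split; [exact: fundamental_sequence_complex | split].
split=> [F_hex|].
  by split=> //; split=> //; exact: half_exact_exact_at_left_derived.
split; first exact: mono_preserving_alpha_monic.
split=> [F_epi|].
  split; first exact: epi_preserving_quot_stab_zero.
  exact: epi_preserving_lambda_epic.
by split; [exact: lambda_iso_right_exact | exact: right_exact_lambda_iso].
Qed.
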